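(* Let $1 \leq m \leq n$ be integers, let $X = \{x_1, \dots, x_m\}$ be a set of $m$ sources, each of weight $1/m$, and let $Y = \{y_1, \dots, y_n\}$ be a set of $n$ targets, each of capacity $1/n$. Let $c(x_i, y_j) \in \mathbb{R}$ be the transport costs, and suppose that for all $i, j \in \{1, \dots, m\}$ with $i \neq j$ and all $k, \ell \in \{1, \dots, n\}$ with $k \neq \ell$, $$c(x_i, y_k) + c(x_j, y_{\ell}) \neq c(x_i, y_{\ell}) + c(x_j, y_k).$$ Then every optimal transport plan satisfies the following. (1) For all $1 \leq i \leq m$, $$\left\lceil \frac{n}{m} \right\rceil \leq \# \left\{1 \leq j \leq n: x_i \text{ sends mass to } y_j \right\} \leq \left\lfloor \frac{n}{m}\right\rfloor + m - 1.$$ (2) $$\left\lceil \frac{n}{m} \right\rceil \leq \frac{1}{m} \sum_{i=1}^{m} \# \left\{1 \leq j \leq n: x_i \text{ sends mass to } y_j \right\} \leq \frac{n}{m} + \sqrt{n}.$$ (3) $$\frac{1}{n} \sum_{j=1}^{n} \# \left\{1 \leq i \leq m: x_i \text{ sends mass to } y_j \right\} \leq 1 + \frac{m}{\sqrt{n}}.$$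
   Context: A transport plan is a matrix $P = (P_{ij}) \in \mathbb{R}_{\geq 0}^{m \times n}$ with $\sum_{j=1}^{n} P_{ij} = \frac{1}{m}$ for every $1 \leq i \leq m$ and $\sum_{i=1}^{m} P_{ij} = \frac{1}{n}$ for every $1 \leq j \leq n$; here $P_{ij}$ is the amount of mass sent from $x_i$ to $y_j$. A transport plan is optimal if it minimizes $\sum_{i=1}^{m}\sum_{j=1}^{n} c(x_i, y_j) P_{ij}$ among all transport plans. For a given plan $P$, ''$x_i$ sends mass to $y_j$'' means $P_{ij} > 0$. The costs $c(x_i,y_j)$ are arbitrary real numbers (one for each pair $(i,j)$) subject only to the stated hypothesis. *)

(* Defs.v *)
From HB Require Import structures.
From mathcomp Require Import all_boot all_order all_algebra.
From mathcomp Require Import reals.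

Set Implicit Arguments.
Unset Strict Implicit.
Unset Printing Implicit Defensive.

Import Order.TTheory GRing.Theory Num.Theory.
Local Open Scope ring_scope.

(* The sources x_i are indexed by 'I_m, the targets y_j by 'I_n; a cost is the
   matrix C with C i j = c(x_i, y_j). *)

Definition transport_plan (R : realType) (m n : nat) (P : 'M[R]_(m, n)) : Prop :=
  [/\ forall i j, 0 <= P i j,
      forall i, \sum_(j < n) P i j = 1 / m%:R
    & forall j, \sum_(i < m) P i j = 1 / n%:R].

Definition transport_cost (R : realType) (m n : nat) (C P : 'M[R]_(m, n)) : R :=
  \sum_(i < m) \sum_(j < n) C i j * P i j.

Definition optimal_plan (R : realType) (m n : nat) (C P : 'M[R]_(m, n)) : Prop :=
  transport_plan P /\
  forall Q : 'M[R]_(m, n), transport_plan Q ->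
    transport_cost C P <= transport_cost C Q.

Definition sends_mass (R : realType) (m n : nat) (P : 'M[R]_(m, n))
  (i : 'I_m) (j : 'I_n) : bool := 0 < P i j.

(* Main.v *)
(** Moving mass around a 4-cycle [x_i, y_k, x_j, y_l] of the support graph of an
optimal plan, in one direction or the other, would strictly decrease the cost
because [c(x_i,y_k) + c(x_j,y_l) <> c(x_i,y_l) + c(x_j,y_k)]; so that bipartite
graph is C4-free. Hence a source shares at most one target with each of the
[m - 1] others, and it fills its unshared targets entirely, so there are at most
[n / m] of these. Counting pairs of sources with a common target
(Kovari-Sos-Turan) bounds the number of edges by [n + m sqrt n]. *)

Require Import Defs.
From HB Require Import structures.
From mathcomp Require Import all_boot all_order all_algebra.
From mathcomp Require Import reals ring lra.

Set Implicit Arguments.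
Unset Strict Implicit.
Unset Printing Implicit Defensive.

Import Order.TTheory GRing.Theory Num.Theory.
Local Open Scope ring_scope.

Lemma transport_costD (R : realType) (m n : nat) (C P Q : 'M[R]_(m, n)) :
  transport_cost C (P + Q) = transport_cost C P + transport_cost C Q.
Proof.
rewrite -big_split; apply: eq_bigr => i _ /=; rewrite -big_split.
by apply: eq_bigr => j _ /=; rewrite mxE mulrDr.
Qed.

Lemma sumr_delta (R : pzSemiRingType) (I : finType) (i : I) (f : I -> R) :
  \sum_a f a * (a == i)%:R = f i.
Proof.
rewrite (bigD1 i) //= eqxx mulr1 big1 ?addr0 // => a /negPf ->.
by rewrite mulr0.
Qed.

(** The signed 4-cycle: [t] leaves [(i, k)] and [(j, l)] and arrives at [(i, l)] and [(j, k)].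
    Written as a product of a row factor and a column factor, each summing to 0, it visibly
    preserves both marginals. *)
Definition swap_mx (R : realType) (m n : nat) (t : R) (i j : 'I_m) (k l : 'I_n) :
  'M[R]_(m, n) :=
  \matrix_(a, b) (t * ((a == j)%:R - (a == i)%:R) * ((b == k)%:R - (b == l)%:R)).

Lemma swap_mx_plan (R : realType) (m n : nat) (P : 'M[R]_(m, n)) (t : R)
    (i j : 'I_m) (k l : 'I_n) :
  transport_plan P -> i != j -> k != l -> 0 <= t -> t <= P i k -> t <= P j l ->
  transport_plan (P + swap_mx t i j k l).
Proof.
move=> [P0 Pr Pc] ij kl t0 tik tjl.
have sumB (T : finType) (x y : T) (c : R) :
    \sum_a c * ((a == x)%:R - (a == y)%:R) = 0.
  under eq_bigr do rewrite mulrBr.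
  by rewrite sumrB (sumr_delta x (fun=> c)) (sumr_delta y (fun=> c)) subrr.
split=> [a b|a|b].
(* Only [(i, k)] and [(j, l)] can lose mass, and they lose [t]; this is what the two upper bounds on
   [t] are for. *)
- rewrite !mxE; have := P0 a b.
  have [->|ai] := eqVneq a i; have [->|bk] := eqVneq b k;
    rewrite ?(negPf ij) ?(negPf kl) /=.
  + by lra.
  + by case: (b == l) => /=; lra.
  + by case: (a == j) => /=; lra.
  + have [->|aj] := eqVneq a j; have [->|bl] := eqVneq b l => /=; lra.
- under eq_bigr do rewrite !mxE.
  by rewrite big_split /= Pr sumB addr0.
- under eq_bigr do rewrite !mxE mulrAC.
  by rewrite big_split /= Pc sumB addr0.
Qed.

Lemma transport_cost_swap_mx (R : realType) (m n : nat) (C : 'M[R]_(m, n)) (t : R)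
    (i j : 'I_m) (k l : 'I_n) :
  transport_cost C (swap_mx t i j k l) =
  t * (C i l + C j k - (C i k + C j l)).
Proof.
have rowE a : \sum_b C a b * swap_mx t i j k l a b =
    (t * (C a k - C a l)) * (a == j)%:R - (t * (C a k - C a l)) * (a == i)%:R.
  transitivity (\sum_b t * ((a == j)%:R - (a == i)%:R) *
      (C a b * (b == k)%:R - C a b * (b == l)%:R)).
    by apply: eq_bigr => b _; rewrite mxE; ring.
  by rewrite -mulr_sumr sumrB !sumr_delta; ring.
rewrite /transport_cost; under eq_bigr do rewrite rowE.
by rewrite sumrB !(sumr_delta _ (fun a => t * (C a k - C a l))); ring.
Qed.

(** Cyclical monotonicity for two pairs: the swap changes the cost by [t] times the difference of
    the two sides, which optimality makes nonnegative. *)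
Lemma optimal_plan_monotone (R : realType) (m n : nat) (C P : 'M[R]_(m, n))
    (i j : 'I_m) (k l : 'I_n) :
  optimal_plan C P -> sends_mass P i k -> sends_mass P j l ->
  C i k + C j l <= C i l + C j k.
Proof.
move=> [planP minP] ik jl.
have [->|ij] := eqVneq i j; first by rewrite addrC.
have [->//|kl] := eqVneq k l.
(* The largest amount that keeps both decreasing entries nonnegative; it is positive since both
   edges carry mass. *)
pose t := Num.min (P i k) (P j l).
have t0 : 0 < t by rewrite lt_min; apply/andP.
have := minP _ (@swap_mx_plan _ _ _ P t i j k l planP ij kl (ltW t0) _ _).
rewrite transport_costD transport_cost_swap_mx lerDl pmulr_rge0 // subr_ge0.
by apply; rewrite /t ge_min lexx ?orbT.
Qed.

Lemma card_set_sum (T : finType) (p : pred T) :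
  #|[set x | p x]| = (\sum_x p x)%N.
Proof.
rewrite cardsE -sum1_card big_mkcond; apply: eq_bigr => x _.
by rewrite unfold_in; case: (p x).
Qed.

Definition C4_free (I J : finType) (r : I -> J -> bool) : Prop :=
  forall i i' j j', r i j -> r i j' -> r i' j -> r i' j' -> i = i' \/ j = j'.

Lemma optimal_plan_C4_free (R : realType) (m n : nat) (C P : 'M[R]_(m, n)) :
  (forall (i j : 'I_m) (k l : 'I_n), i <> j -> k <> l ->
     C i k + C j l <> C i l + C j k) ->
  optimal_plan C P -> C4_free (sends_mass P).
Proof.
move=> hC hP i j k l ik il jk jl.
have [|/eqP ij] := eqVneq i j; first by left.
have [|/eqP kl] := eqVneq k l; first by right.
(* All four edges carry mass, so monotonicity holds for both matchings of the cycle and forces the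
   excluded equality. *)
case: (hC i j k l ij kl); apply/le_anti/andP.
by split; apply: optimal_plan_monotone hP _ _.
Qed.

Section C4Free.
Variables (I J : finType) (r : I -> J -> bool).
Hypothesis r_free : C4_free r.

Lemma C4_free_codegree (i i' : I) : i != i' -> (\sum_j r i j * r i' j <= 1)%N.
Proof.
move=> ii'; have -> : (\sum_j r i j * r i' j = #|[set j | r i j && r i' j]|)%N.
  by rewrite card_set_sum; apply: eq_bigr => j _; rewrite mulnb.
apply/card_le1_eqP => j j'; rewrite !inE => /andP[ij i'j] /andP[ij' i'j'].
by case: (r_free ij' ij i'j' i'j) => // ei; rewrite ei eqxx in ii'.
Qed.

(** The left side counts triples [(i, i', j)] with [j] adjacent to both [i] and [i']. Those with
    [i = i'] are the edges; every other ordered pair has at most one common [j]. *)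
Lemma C4_free_sum_sqr :
  (\sum_j #|[set i | r i j]| ^ 2 <=
   \sum_j #|[set i | r i j]| + #|I| * #|I|.-1)%N.
Proof.
under eq_bigr do rewrite card_set_sum expnS expn1 big_distrlr /=.
under [X in (_ <= X + _)%N]eq_bigr do rewrite card_set_sum.
rewrite exchange_big [X in (_ <= X + _)%N]exchange_big /=.
rewrite -sum_nat_const -big_split; apply: leq_sum => i _ /=.
rewrite exchange_big (bigD1 i) //= leq_add //.
  by rewrite leq_sum // => j _; case: (r i j).
rewrite -(cardC1 i) -sum1_card; apply: leq_sum => i'; rewrite eq_sym.
exact: C4_free_codegree.
Qed.

(** Charge each shared [j] to the other vertices [i'] adjacent to it; each [i'] is charged at most
    once. *)
Lemma C4_free_shared (i : I) :
  (#|[set j | r i j && [exists i', (i' != i) && r i' j]]| <= #|I|.-1)%N.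
Proof.
rewrite cardsE -sum1_card -(cardC1 i) -[leqRHS]sum1_card.
apply: (@leq_trans (\sum_(i' | i' != i) \sum_j r i j * r i' j)).
  rewrite exchange_big [leqLHS]big_mkcond; apply: leq_sum => j _ /=.
  case: ifP => //; rewrite unfold_in => /andP[ij /existsP[i' /andP[ii' i'j]]].
  by rewrite (bigD1 i') //= ij i'j.
by apply: leq_sum => i'; rewrite eq_sym; exact: C4_free_codegree.
Qed.

End C4Free.

(* [2 m s x <= s^2 x^2 + m^2] with [s = sqrt n] and [x = d_j - 1], summed over [j]. *)
Lemma C4_free_edge_bound (R : realType) (m n : nat) (r : 'I_m -> 'I_n -> bool) :
  C4_free r -> (0 < m)%N -> (0 < n)%N ->
  (forall j, 0 < #|[set i | r i j]|)%N ->
  \sum_(j < n) #|[set i | r i j]|%:R <= n%:R + m%:R * Num.sqrt n%:R :> R.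
Proof.
move=> r_free m0 n0 d0; set d := fun j => #|[set i | r i j]|.
pose s : R := Num.sqrt n%:R; pose e : R := \sum_j (d j)%:R.
have s2 : s ^+ 2 = n%:R by rewrite sqr_sqrtr.
have s0 : 0 < s by rewrite sqrtr_gt0 ltr0n.
have m0R : 0 < m%:R :> R by rewrite ltr0n.
have nE : n%:R = \sum_(j < n) 1 :> R by rewrite sumr_const card_ord.
have e_ge : n%:R <= e.
  by rewrite nE; apply: ler_sum => j _; rewrite ler1n d0.
have sqr_le : \sum_j (d j)%:R ^+ 2 <= e + m%:R ^+ 2 :> R.
  have := C4_free_sum_sqr r_free; rewrite card_ord -(ler_nat R) natrD !natr_sum.
  under eq_bigr do rewrite natrX.
  move=> /le_trans; apply; rewrite lerD2l natrM expr2.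
  by rewrite ler_wpM2l // ler_nat leq_pred.
(* Expanding the square and using [sqr_le] leaves [m^2 + n - e], and [e >= n] because no degree
   vanishes. *)
have sum_sqr : \sum_j ((d j)%:R - 1) ^+ 2 <= m%:R ^+ 2 :> R.
  have -> : \sum_j ((d j)%:R - 1) ^+ 2 = \sum_j (d j)%:R ^+ 2 - 2 * e + n%:R :> R.
    rewrite mulr_sumr -sumrB nE -big_split.
    by apply: eq_bigr => j _ /=; ring.
  lra.
have amgm : 2 * m%:R * s * (e - n%:R) <= 2 * m%:R * s * (m%:R * s).
  apply: (@le_trans _ _ (s ^+ 2 * \sum_j ((d j)%:R - 1) ^+ 2 + n%:R * m%:R ^+ 2)).
    rewrite nE -sumrB !mulr_sumr mulr_suml -big_split; apply: ler_sum => j _ /=.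
    rewrite -subr_ge0; have := sqr_ge0 (s * ((d j)%:R - 1) - m%:R).
    by congr (0 <= _); ring.
  have -> : 2 * m%:R * s * (m%:R * s) = s ^+ 2 * m%:R ^+ 2 + s ^+ 2 * m%:R ^+ 2 by ring.
  by rewrite s2 lerD2r ler_wpM2l.
have ms0 : 0 < 2 * m%:R * s by rewrite !mulr_gt0.
by rewrite -lerBlDl -(ler_pM2l ms0).
Qed.

Section SupportOfPlan.
Variables (R : realType) (m n : nat) (P : 'M[R]_(m, n)).
Hypotheses (n0 : (0 < n)%N) (planP : transport_plan P).

Lemma plan_entry_le i j : P i j <= 1 / n%:R.
Proof.
by case: planP => P0 _ /(_ j) <-; rewrite (bigD1 i) //= lerDl sumr_ge0.
Qed.

(** Each target used absorbs at most its capacity [1/n] of the mass [1/m]. *)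
Lemma plan_row_support i : n%:R / m%:R <= #|[set j | sends_mass P i j]|%:R :> R.
Proof.
have [P0 /(_ i) Pr _] := planP.
have nR : 0 < n%:R :> R by rewrite ltr0n.
rewrite -[m%:R^-1]div1r -Pr card_set_sum natr_sum mulr_sumr.
apply: ler_sum => j _; rewrite /sends_mass; case: ltrP => [_|Pij].
  by rewrite -ler_pdivlMl // mulrC plan_entry_le.
by rewrite mulr_ge0_le0 // ltW.
Qed.

Lemma plan_col_support j : (0 < #|[set i | sends_mass P i j]|)%N.
Proof.
have [P0 _ /(_ j) Pc] := planP.
rewrite card_gt0; apply/set0Pn.
have [i ij|no] := pickP (sends_mass P ^~ j); first by exists i; rewrite inE.
have : 1 / n%:R <= 0 :> R.
  by rewrite -Pc sumr_le0 // => i _; rewrite leNgt; exact: negbT (no i).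
by rewrite leNgt div1r invr_gt0 ltr0n n0.
Qed.

(** An unshared target gets its whole capacity [1/n] from [i], which has only [1/m] to give. *)
Lemma plan_unshared i :
  #|[set j | sends_mass P i j && ~~ [exists i', (i' != i) && sends_mass P i' j]]|%:R
    <= n%:R / m%:R :> R.
Proof.
have [P0 /(_ i) Pr Pc] := planP.
have nR : 0 < n%:R :> R by rewrite ltr0n.
rewrite -[m%:R^-1]div1r -Pr card_set_sum natr_sum mulr_sumr.
apply: ler_sum => j _; case: andP => [[_ /existsPn alone]|_]; last first.
  by rewrite mulr_ge0.
rewrite -ler_pdivrMl // mulrC -(Pc j) (bigD1 i) //= big1 ?addr0 // => i' ii'.
by apply/le_anti; rewrite P0 andbT leNgt; have := alone i'; rewrite ii'.
Qed.

End SupportOfPlan.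

Theorem mainTheorem1 (R : realType) (m n : nat)
    (hm : (1 <= m)%N) (hmn : (m <= n)%N)
    (C : 'M[R]_(m, n))
    (hC : forall (i j : 'I_m) (k l : 'I_n), i <> j -> k <> l ->
       C i k + C j l <> C i l + C j k)
    (P : 'M[R]_(m, n)) (hP : optimal_plan C P) :
  [/\ forall i : 'I_m,
        Num.ceil (n%:R / m%:R : R) <= #|[set j : 'I_n | sends_mass P i j]|%:Z
        /\ #|[set j : 'I_n | sends_mass P i j]|%:Z
             <= Num.floor (n%:R / m%:R : R) + m%:Z - 1,
      (Num.ceil (n%:R / m%:R : R))%:~R
        <= 1 / m%:R * \sum_(i < m) #|[set j : 'I_n | sends_mass P i j]|%:R :> R
      /\ 1 / m%:R * \sum_(i < m) #|[set j : 'I_n | sends_mass P i j]|%:R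
        <= n%:R / m%:R + Num.sqrt n%:R :> R
    & 1 / n%:R * \sum_(j < n) #|[set i : 'I_m | sends_mass P i j]|%:R
        <= 1 + m%:R / Num.sqrt n%:R :> R].
Proof.
have n0 : (0 < n)%N := leq_trans hm hmn.
have mR : 0 < m%:R :> R by rewrite ltr0n.
have nR : 0 < n%:R :> R by rewrite ltr0n.
have s0 : 0 < Num.sqrt n%:R :> R by rewrite sqrtr_gt0.
have planP := hP.1.
have r_free := optimal_plan_C4_free hC hP.
have row_ge i : Num.ceil (n%:R / m%:R : R) <= #|[set j | sends_mass P i j]|%:Z.
  (* The count is an integer, so it bounds the ceiling as soon as it bounds [n/m]. *)
  by rewrite ceil_le_int // -[_%:~R]/(_%:R) plan_row_support.
have size_le := C4_free_edge_bound R r_free hm n0 (plan_col_support n0 planP).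
have double_count : \sum_i #|[set j | sends_mass P i j]|%:R =
    \sum_j #|[set i | sends_mass P i j]|%:R :> R.
  rewrite -!natr_sum; under eq_bigr do rewrite card_set_sum.
  by rewrite exchange_big; under [in RHS]eq_bigr do rewrite card_set_sum.
split.
- move=> i; split; first exact: row_ge.
  (* Split the targets of [i] into shared ones, at most [m - 1], and unshared ones, at most the
     floor of [n/m]. *)
  rewrite -[X in X%:Z](cardsID [set j | [exists i', (i' != i) && sends_mass P i' j]]).
  rewrite PoszD -addrA [leLHS]addrC lerD //.
    rewrite floor_ge_int // -[_%:~R]/(_%:R).
    rewrite (le_trans _ (plan_unshared n0 planP i)) // ler_nat subset_leq_card //.
    by apply/subsetP => j; rewrite !inE andbC.
  rewrite -predn_int // lez_nat.
  have := C4_free_shared r_free i; rewrite card_ord; apply: leq_trans.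
  by apply: subset_leq_card; apply/subsetP => j; rewrite !inE.
- rewrite div1r; split.
    rewrite ler_pdivlMl // mulrC.
    rewrite -[X in _ * X%:R]card_ord mulr_natr -sumr_const; apply: ler_sum => i _.
    by have := row_ge i; rewrite -(ler_int R).
  rewrite double_count ler_pdivrMl // mulrDr mulrCA divff ?gt_eqF // mulr1.
  exact: size_le.
- rewrite div1r ler_pdivrMl // mulrDr mulr1 (le_trans size_le) // lerD2l.
  (* Here [n / sqrt n] is compared with [sqrt n]. *)
  by rewrite mulrCA ler_wpM2l // ler_pdivlMr // -expr2 sqr_sqrtr.
Qed.
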